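(* Let $F$ be a finite field with $|F|=q$, and let $V$ be a vector space over $F$ with $\dim(V)=n$. If $n$ is odd, then $$w(G(V))=\sum_{i=1}^{\lfloor n/2\rfloor} \begin{bmatrix} n \\ i \end{bmatrix}_{q}.$$
   Context: For a finite-dimensional vector space $V$ over a finite field, the intersection graph of subspaces $G(V)$ is the simple graph whose vertices are the proper nontrivial subspaces of $V$ (i.e. subspaces $W$ with $W\neq 0$ and $W\neq V$), two distinct vertices being adjacent if and only if the corresponding subspaces have nonzero intersection. The clique number $w(G)$ of a graph $G$ is the maximum size of a set of pairwise adjacent vertices of $G$. For $t\in\{1,\dots,n\}$, $\begin{bmatrix} n \\ t \end{bmatrix}_{q}=\prod_{0\leq i<t}\frac{q^{n-i}-1}{q^{t-i}-1}$ is the number of $t$-dimensional subspaces of an $n$-dimensional vector space over the field with $q$ elements; also $\begin{bmatrix} n \\ 0 \end{bmatrix}_{q}=1$ and $\begin{bmatrix} n \\ t \end{bmatrix}_{q}=0$ if $t\notin\{0,1,\dots,n\}$. *)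

(* Defs.v *)
From HB Require Import structures.
From mathcomp Require Import all_boot all_order all_algebra.

Set Implicit Arguments.
Unset Strict Implicit.
Unset Printing Implicit Defensive.

Import GRing.Theory.
Local Open Scope ring_scope.

Record simple_graph := SimpleGraph {
  vertex :> finType;
  adj : rel vertex;
  adj_sym : symmetric adj;
  adj_irr : irreflexive adj
}.

Definition clique (G : simple_graph) (A : {set G}) : bool :=
  [forall x in A, forall y in A, (x != y) ==> adj x y].

(* set0 is always a clique, so this is a genuine maximum; it is 0 exactly on
   the graph without vertices. *)
Definition clique_number (G : simple_graph) : nat :=
  (\max_(A : {set G} | clique A) #|A|)%N.

(* {vspace V} is a subtype of square matrices, but the library keeps that
   instance in VectorInternalTheory. *)
Module VspaceFinite.
Import VectorInternalTheory.
#[export] HB.instance Definition _ (F : finFieldType) (V : vectType F) :=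
  [Countable of {vspace V} by <:].
#[export] HB.instance Definition _ (F : finFieldType) (V : vectType F) :=
  [Finite of {vspace V} by <:].
Module Exports. HB.reexport VspaceFinite. End Exports.
End VspaceFinite.
Export VspaceFinite.Exports.

Section SubspaceGraph.
Variables (F : finFieldType) (V : vectType F).

Definition proper_subspace : finType :=
  {W : {vspace V} | (W != 0%VS) && (W != fullv)}.

Definition meets : rel proper_subspace :=
  fun U W => (U != W) && ((val U :&: val W)%VS != 0%VS).

Lemma meets_sym : symmetric meets.
Proof. by move=> U W; rewrite /meets eq_sym capvC. Qed.

Lemma meets_irr : irreflexive meets.
Proof. by move=> U; rewrite /meets eqxx. Qed.

Definition subspace_graph : simple_graph := SimpleGraph meets_sym meets_irr.

End SubspaceGraph.

(* The formula is stated in rat so that / is exact division; n - i and t - i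
   are subtractions of naturals, never truncated since i < t <= n. *)
Definition gauss_binom (q n t : nat) : rat :=
  if (t <= n)%N then
    \prod_(i < t) ((q%:R ^+ (n - i) - 1) / (q%:R ^+ (t - i) - 1))
  else 0.

(* Main.v *)
Require Import Defs.
From mathcomp Require Import all_boot all_order all_algebra.
From mathcomp Require Import finfield zify.

(** The clique number is half the number of vertices.  Write [n = 2k + 1] and
    let [Gr i] be the set of subspaces of dimension [i].

    Lower bound: two subspaces of dimension greater than [k] always meet, since
    their dimensions add up to more than [n].  Hence the proper subspaces of
    dimension greater than [k] form a clique.  As [Gr i] and [Gr (n - i)] have
    the same size, its size is the sum of the [#|Gr i|] for [1 <= i <= k].

    Upper bound: it suffices that, for [1 <= i <= k], a clique has at most
    [#|Gr i|] members of dimension [i] or [n - i].  Join [U] in [Gr i] to [W] in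
    [Gr (n - i)] when [U] and [W] are complementary, i.e. do not meet.  This
    bipartite graph is regular on both sides, of the same degree
    [q ^ (i * (n - i))] ([card_complements]), and the members of a clique form
    an independent set in it.  In a regular bipartite graph of positive degree
    an independent set is no larger than either side: the edges leaving its two
    halves are disjoint ([leq_card_meeting]).  The equality
    [#|Gr i| = #|Gr (n - i)|] is another consequence of this regularity.

    Both the degree and the size of [Gr i] come from one count
    ([card_disjoint_subspaces]): the [t]-tuples of vectors that are independent
    modulo a subspace [U] are counted by choosing the vectors one at a time, and
    every [t]-dimensional space disjoint from [U] is spanned by the same number
    of them. *)

Set Implicit Arguments.
Unset Strict Implicit.
Unset Printing Implicit Defensive.

Import GRing.Theory Num.Theory.

(** * Counting tuples of vectors *)

Section Counting.

Variables (F : finFieldType) (V : vectType F).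
Local Notation q := #|F|.
Local Notation vec := (finvect_type V).
Implicit Types (U W Y : {vspace V}) (t : nat).

Lemma card_vspace_elements W : #|[set x : vec | (x : V) \in W]| = q ^ \dim W.
Proof.
(* Exposing the record V identifies it with the finite type on its carrier. *)
rewrite cardsE; case: V W => T c W.
exact: (@card_vspace F (finvect_type (Vector.Pack c)) c).
Qed.

Lemma card_vspace_diff U W : (U <= W)%VS ->
  #|[set x : vec | ((x : V) \in W) && ((x : V) \notin U)]|
    = q ^ \dim W - q ^ \dim U.
Proof.
move=> sUW.
rewrite -!card_vspace_elements -cardsDS.
  by apply: eq_card => x; rewrite !inE andbC.
by apply/subsetP => x; rewrite !inE; apply: (subvP sUW).
Qed.

Lemma dim_add_vline (v : V) Y : \dim (<[v]> + Y) = (v \notin Y) + \dim Y.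
Proof.
have [vY | vY] := boolP (v \in Y); first by rewrite (addv_idPr _).
apply/eqP; rewrite eqn_leq; apply/andP; split.
  apply: leq_trans (dimv_add_leqif _ _) _.
  by rewrite leq_add2r dim_vline; case: (v != 0%R).
have [leY eqY] := dimv_leqif_eq (addvSr <[v]>%VS Y).
rewrite /= add1n ltn_neqAle leY eqY andbT; apply: contra vY => /eqP->.
by rewrite memvE addvSl.
Qed.

(** Linear independence modulo [U], expressed by a dimension: for [U = 0] and
    [t = \dim W] these are the ordered bases of [W]. *)
Definition frames U W t : {set t.-tuple vec} :=
  [set X : t.-tuple vec |
    (<<(X : seq V)>> <= W)%VS && (\dim (U + <<(X : seq V)>>) == \dim U + t)].

Lemma dim_add_span U t (X : t.-tuple vec) :
  \dim (U + <<(X : seq V)>>) <= \dim U + t.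
Proof.
apply: leq_trans (dimv_add_leqif _ _) _; rewrite leq_add2l.
by apply: leq_trans (dim_span _) _; rewrite size_tuple.
Qed.

(** A frame is prolonged by exactly the vectors of [W] outside the space
    that it spans together with [U]. *)
Lemma frames_cons U W t (x : vec) (X : t.-tuple vec) :
  ([tuple of x :: X] \in frames U W t.+1)
    = (X \in frames U W t)
      && (((x : V) \in W) && ((x : V) \notin (U + <<(X : seq V)>>)%VS)).
Proof.
rewrite !inE span_cons subv_add -memvE addvA (addvC U) -addvA dim_add_vline.
have := dim_add_span U X.
case: (_ \in W) => //=; last by rewrite andbF.
move=> le_dim; rewrite -andbA; congr (_ && _).
by move: le_dim; case: (_ \in _) => /=; lia.
Qed.

Lemma card_frames U W t : (U <= W)%VS ->
  #|frames U W t| = \prod_(j < t) (q ^ \dim W - q ^ (\dim U + j)).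
Proof.
move=> sUW; elim: t => [|t IHt].
  rewrite big_ord0 (_ : frames _ _ _ = setT) ?cardsT ?card_tuple //.
  by apply/setP => X; rewrite tuple0 !inE span_nil sub0v addv0 addn0 eqxx.
rewrite big_ord_recr /= -IHt -[LHS]sum1_card.
pose cons_pair (p : t.-tuple vec * vec) := [tuple of p.2 :: p.1].
rewrite (reindex cons_pair) /=; last first.
  exists (fun X : t.+1.-tuple vec => ([tuple of behead X], thead X))
    => [[X x] _ | X _] /=.
    by congr (_, _); apply: val_inj.
  by rewrite /cons_pair /= -tuple_eta.
rewrite (eq_bigl (fun p : t.-tuple vec * vec => (p.1 \in frames U W t) &&
  (((p.2 : V) \in W) && ((p.2 : V) \notin (U + <<(p.1 : seq V)>>)%VS))));
  last by move=> p; rewrite frames_cons.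
rewrite -(pair_big_dep (fun X => X \in frames U W t)
  (fun (X : t.-tuple vec) (x : vec) =>
     ((x : V) \in W) && ((x : V) \notin (U + <<(X : seq V)>>)%VS))
  (fun _ _ => 1)) /=.
rewrite -sum_nat_const; apply: eq_bigr => X; rewrite inE => /andP[sXW /eqP dX].
rewrite -[in RHS]dX -card_vspace_diff ?subv_add ?sUW // -sum1_card.
by apply: eq_bigl => x; rewrite inE.
Qed.

(** * Counting subspaces *)

Definition Gr t : {set {vspace V}} := [set W | \dim W == t].

Definition disjoint_subspaces U t : {set {vspace V}} :=
  [set W in Gr t | (U :&: W)%VS == 0%VS].

Lemma dim_add_eq_disjoint U W :
  (\dim (U + W) == \dim U + \dim W) = ((U :&: W)%VS == 0%VS).
Proof.
by rewrite -dimv_sum_cap -{1}[\dim _]addn0 eqn_add2l eq_sym dimv_eq0.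
Qed.

(** The frames modulo [U] are sorted according to the space that they span;
    those spanning a given [W] are the bases of [W]. *)
Lemma card_disjoint_subspaces U t :
  #|disjoint_subspaces U t| * \prod_(j < t) (q ^ t - q ^ j)
    = \prod_(j < t) (q ^ \dim {:V} - q ^ (\dim U + j)).
Proof.
rewrite -card_frames ?subvf // -[RHS]sum1_card.
rewrite (partition_big (fun X : t.-tuple vec => <<(X : seq V)>>%VS)
           [in disjoint_subspaces U t]) /=; last first.
  move=> X; rewrite !inE => /andP[_ /eqP dX].
  have dimX : \dim <<(X : seq V)>> = t.
    apply/eqP; rewrite eqn_leq.
    have := dim_span (X : seq V); rewrite size_tuple => -> /=.
    by have := (dimv_add_leqif U <<(X : seq V)>>%VS).1; rewrite dX leq_add2l.
  by rewrite -dim_add_eq_disjoint dX dimX !eqxx.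
rewrite -sum_nat_const; apply: eq_bigr => W; rewrite !inE => /andP[/eqP dW UW].
transitivity #|frames 0 W t|.
  by rewrite card_frames ?sub0v // dW dimv0.
rewrite -sum1_card; apply: eq_bigl => X.
rewrite !inE subvf add0v dimv0 add0n.
apply/andP/andP => [[sXW /eqP dX] | [_ /eqP->]]; last by rewrite subvv dW.
have eXW : <<(X : seq V)>>%VS = W by apply/eqP; rewrite eqEdim sXW dW dX /=.
by rewrite eXW -{1}dW dim_add_eq_disjoint.
Qed.

Lemma card_field_gt1 : 1 < q.
Proof. exact: finNzRing_gt1. Qed.

Lemma prod_bases_gt0 t : 0 < \prod_(j < t) (q ^ t - q ^ j).
Proof.
by apply: prodn_gt0 => j; rewrite subn_gt0 ltn_exp2l ?ltn_ord ?card_field_gt1.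
Qed.

(** The right-hand side of [card_disjoint_subspaces] is now [q ^ (\dim U * t)]
    times the number of bases of a [t]-dimensional space. *)
Lemma card_complements U t : \dim U + t = \dim {:V} ->
  #|disjoint_subspaces U t| = q ^ (\dim U * t).
Proof.
move=> dUt; apply/eqP; rewrite -(eqn_pmul2r (prod_bases_gt0 t)).
rewrite card_disjoint_subspaces -dUt expnM -[t in (_ ^ _) ^ t]card_ord.
rewrite -prod_nat_const -big_split /=; apply/eqP/eq_bigr => j _.
by rewrite mulnBr -!expnD.
Qed.

(** Every subspace is disjoint from [0], so this is the case [U = 0] of
    [card_disjoint_subspaces], once each factor [q ^ m - q ^ j] is divided by
    [q ^ j]. *)
Lemma card_Gr t :
  t <= \dim {:V} -> (#|Gr t|%:R = gauss_binom q (\dim {:V}) t)%R.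
Proof.
move=> le_tn; rewrite /gauss_binom le_tn.
have q_neq0 : (q%:R != 0 :> rat)%R.
  by rewrite pnatr_eq0 -lt0n (ltn_trans _ card_field_gt1).
have count := card_disjoint_subspaces 0 t.
have {count} : #|Gr t| * \prod_(j < t) (q ^ t - q ^ j)
    = \prod_(j < t) (q ^ \dim {:V} - q ^ j).
  transitivity (#|disjoint_subspaces 0 t| * \prod_(j < t) (q ^ t - q ^ j)).
    by congr (_ * _); apply: eq_card => W; rewrite !inE cap0v eqxx andbT.
  by rewrite count dimv0.
move/(congr1 (fun m => m%:R : rat)%R); rewrite natrM => count.
have prod_neq0 : ((\prod_(j < t) (q ^ t - q ^ j))%:R != 0 :> rat)%R.
  by rewrite pnatr_eq0 -lt0n prod_bases_gt0.
apply: (mulIf prod_neq0); rewrite {}count !natr_prod -big_split /=.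
apply: eq_bigr => j _.
have lejt : j <= t by apply: ltnW.
have factor m : j <= m ->
    ((q ^ m - q ^ j)%:R = q%:R ^+ j * (q%:R ^+ (m - j) - 1) :> rat)%R.
  move=> lejm; rewrite natrB ?leq_pexp2l // ?(ltnW card_field_gt1) //.
  by rewrite !natrX mulrBr mulr1 -exprD subnKC.
rewrite !factor // ?(leq_trans lejt) //.
have neq0 : (q%:R ^+ (t - j) - 1 != 0 :> rat)%R.
  rewrite subr_eq0 -natrX pnatr_eq1 -(expn0 q) eqn_exp2l ?card_field_gt1 //.
  by rewrite subn_eq0 -ltnNge.
by rewrite mulrCA divfK.
Qed.

(** * Pairwise meeting families of complementary dimensions *)

(** Double counting of the complementary pairs [(U, W)] with [U] in [S]: each
    [U] has exactly [q ^ (i * j)] complements [W], none of which lies in [T],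
    and each [W] has at most [q ^ (i * j)] complements in [S]. *)
Lemma leq_card_meeting i j (S T : {set {vspace V}}) :
    i + j = \dim {:V} -> S \subset Gr i -> T \subset Gr j ->
    {in S & T, forall U W, (U :&: W)%VS != 0%VS} ->
  #|S| + #|T| <= #|Gr j|.
Proof.
move=> dij sSG sTG meetST.
have q_gt0 : 0 < q ^ (i * j) by rewrite expn_gt0 (ltn_trans _ card_field_gt1).
rewrite addnC -leq_subRL ?subset_leq_card // -cardsDS //.
rewrite -(leq_pmul2r q_gt0) -!sum_nat_const.
rewrite (eq_bigr (fun U => \sum_(W in disjoint_subspaces U j) 1)); last first.
  move=> U US; have := subsetP sSG U US; rewrite inE => /eqP dU.
  by rewrite sum1_card card_complements dU.
rewrite (exchange_big_dep [in Gr j :\: T]) /=; last first.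
  move=> U W US; rewrite in_setD [in X in X -> _]inE => /andP[-> UW].
  by rewrite andbT; apply: contraTN UW; apply: meetST.
apply: leq_sum => W; rewrite !inE => /andP[_ /eqP dW].
rewrite mulnC -dW -card_complements; last by rewrite dW addnC.
rewrite sum1_card; apply: subset_leq_card; apply/subsetP => U.
rewrite unfold_in !inE => /andP[US /andP[_ UW]]; rewrite capvC UW andbT.
by have := subsetP sSG U US; rewrite inE.
Qed.

(** Taking for [S] a whole side and for [T] the empty set bounds each side by
    the other. *)
Lemma card_Gr_sym i j : i + j = \dim {:V} -> #|Gr i| = #|Gr j|.
Proof.
have le_Gr a b : a + b = \dim {:V} -> #|Gr a| <= #|Gr b|.
  move=> dab; rewrite -[#|Gr a|]addn0 -(cards0 {vspace V}).
  apply: leq_card_meeting dab _ _ _; rewrite ?sub0set // => U W _.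
  by rewrite inE.
by move=> dij; apply/eqP; rewrite eqn_leq !le_Gr // addnC.
Qed.

End Counting.

(** * The clique number *)

Lemma card_fibers (T : finType) (B : {set T}) (f : T -> nat) k :
    {in B, forall x, 0 < f x <= k} ->
  #|B| = \sum_(1 <= i < k.+1) #|[set x in B | f x == i]|.
Proof.
move=> fB; under eq_bigr => i _ do rewrite -sum1_card.
rewrite -sum1_card (exchange_big_dep [in B]) /=; last first.
  by move=> i x _ /[!inE] /andP[].
apply: eq_bigr => x Bx; rewrite (eq_bigl (pred1 (f x))); last first.
  by move=> i; rewrite !inE Bx eq_sym.
by rewrite sum1_count count_uniq_mem ?iota_uniq // mem_index_iota ltnS fB.
Qed.

Section CliqueNumber.

Variables (F : finFieldType) (V : vectType F).
Local Notation n := (\dim {:V}).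
Hypothesis odd_dim : odd n.

Lemma dim_proper_subspace (W : proper_subspace V) : 0 < \dim (val W) < n.
Proof.
have /andP[W0 WV] := valP W; have [leW eqW] := dimv_leqif_eq (subvf (val W)).
by rewrite lt0n dimv_eq0 W0 ltn_neqAle eqW WV leW.
Qed.

(** The members of dimension [i] and those of dimension [n - i] are grouped
    together by taking the smaller of the dimension and the codimension. *)
Lemma leq_card_clique (A : {set subspace_graph V}) :
  clique A -> #|A| <= \sum_(1 <= i < n./2.+1) #|Gr V i|.
Proof.
move=> /forall_inP clA.
set B : {set {vspace V}} := [set val W | W : proper_subspace V in A].
have -> : #|A| = #|B| by rewrite card_imset //; apply: val_inj.
have meetB : {in B &, forall U W, U != W -> (U :&: W)%VS != 0%VS}.
  move=> _ _ /imsetP[U UA ->] /imsetP[W WA ->] neqUW.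
  have /forall_inP/(_ W WA)/implyP := clA U UA.
  by case/(_ _)/andP => //; apply: contraNneq neqUW => ->.
pose f (W : {vspace V}) := minn (\dim W) (n - \dim W).
rewrite (@card_fibers _ B f n./2); last first.
  move=> _ /imsetP[W _ ->]; rewrite /f.
  by have := dim_proper_subspace W; move: odd_dim; lia.
rewrite !big_nat; apply: leq_sum => i /andP[i_gt0 lein].
have dij : (n - i) + i = n by move: lein; lia.
apply: leq_trans (leq_card_meeting (S := B :&: Gr V (n - i)) (T := B :&: Gr V i)
  dij (subsetIr _ _) (subsetIr _ _) _); last first.
  move=> U W /setIP[UB]; rewrite inE => /eqP dU.
  move=> /setIP[WB]; rewrite inE => /eqP dW.
  (* U and W differ because n is odd, so that i and n - i are distinct. *)
  apply: meetB => //; apply: contraTneq odd_dim => eqUW.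
  by move: dW; rewrite -eqUW dU; move: lein; lia.
apply: leq_trans (leq_card_setU _ _); apply: subset_leq_card.
apply/subsetP => W; rewrite !inE /f => /andP[-> /eqP eqi] /=.
by have := dimvS (subvf W); move: eqi lein; lia.
Qed.

Lemma large_subspaces_meet (U W : {vspace V}) :
  n./2 < \dim U -> n./2 < \dim W -> (U :&: W)%VS != 0%VS.
Proof.
rewrite -dim_add_eq_disjoint; have := dimvS (subvf (U + W)%VS).
by move: odd_dim; lia.
Qed.

Definition large_subspaces : {set proper_subspace V} :=
  [set W | n./2 < \dim (val W)].

Lemma large_subspaces_clique :
  clique (large_subspaces : {set subspace_graph V}).
Proof.
apply/forall_inP => U; rewrite inE => dU.
apply/forall_inP => W; rewrite inE => dW.
by apply/implyP => neqUW; apply/andP; split=> //; apply: large_subspaces_meet.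
Qed.

(** The members are counted by codimension, which runs from [1] to [n./2]. *)
Lemma card_large_subspaces :
  #|large_subspaces| = \sum_(1 <= i < n./2.+1) #|Gr V i|.
Proof.
rewrite -(card_imset _ (@val_inj _ _ (proper_subspace V))).
rewrite (@card_fibers _ _ (fun W => n - \dim W) n./2); last first.
  move=> _ /imsetP[W + ->]; rewrite inE.
  by move: (\dim (val W)) (dim_proper_subspace W) => d; lia.
rewrite !big_nat; apply: eq_bigr => i /andP[i_gt0 lein].
rewrite (@card_Gr_sym _ _ i (n - i)); last by move: lein; lia.
apply: eq_card => W; rewrite !inE; apply/andP/eqP => [[_ /eqP eqi] | dW].
  by have := dimvS (subvf W); move: eqi; lia.
split; last by rewrite dW; move: lein; lia.
have properW : (W != 0%VS) && (W != fullv).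
  rewrite -dimv_eq0 dW; apply/andP; split; first by move: lein; lia.
  by apply/eqP => eqW; move: dW; rewrite eqW; move: lein; lia.
apply/imsetP; exists (Sub W properW : proper_subspace V) => //.
by rewrite inE /= dW; move: odd_dim lein; lia.
Qed.

End CliqueNumber.

Theorem theorem7 (F : finFieldType) (V : vectType F) (q n : nat)
    (hq : #|F| = q) (hn : (\dim {:V})%VS = n) (hodd : odd n) :
  ((clique_number (subspace_graph V))%:R
   = \sum_(1 <= i < (n./2).+1) gauss_binom q n i :> rat)%R.
Proof.
subst q n.
have -> : clique_number (subspace_graph V)
    = \sum_(1 <= i < (\dim {:V})./2.+1) #|Gr V i|.
  apply/eqP; rewrite eqn_leq; apply/andP; split.
    by apply/bigmax_leqP => A; apply: leq_card_clique.
  rewrite -card_large_subspaces //.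
  exact/leq_bigmax_cond/large_subspaces_clique.
rewrite natr_sum !big_nat; apply: eq_bigr => i /andP[_ lein].
by apply: card_Gr; move: lein; lia.
Qed.
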